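(* Let $A$ be a commutative ring, $S=A[x_0,\dots,x_d]$, and $P_{S|A}=S\otimes_AS=A[\boldsymbol{x},\boldsymbol{y}]$ with $x_i=x_i\otimes1$, $y_i=1\otimes x_i$, and $\Delta_{S|A}=(y_0-x_0,\dots,y_d-x_d)$. Let $\Theta:H^{d+1}_{\Delta_{S|A}}(P_{S|A})\to D_{S|A}$ be the $P_{S|A}$-linear isomorphism determined by \[ \Theta\left(\left[\frac{1}{(y_0-x_0)^{a_0+1}\cdots(y_d-x_d)^{a_d+1}}\right]\right)=\partial_{a_0,\dots,a_d}\quad(a_i\ge0). \] Then $\Theta$ is an isomorphism of $D_{S|A}$-modules.
   Context: $D_{S|A}$ is the ring of $A$-linear differential operators on $S$; $\partial_{a_0,\dots,a_d}$ is the $A$-linear map on $S$ with $\partial_{a_0,\dots,a_d}(x_0^{b_0}\cdots x_d^{b_d})=\prod_i\binom{b_i}{a_i}x_0^{b_0-a_0}\cdots x_d^{b_d-a_d}$. $P_{S|A}$ acts on $D_{S|A}$ by $(s_1\otimes s_2)\cdot\delta=\tilde s_1\circ\delta\circ\tilde s_2$ ($\tilde s$ = multiplication by $s$). $D_{S|A}$ acts on itself by left multiplication. $D_{S|A}$ acts on $P_{S|A}=S\otimes_AS$ via $\delta\mapsto\delta\otimes1$ (i.e., on the $\boldsymbol{x}$ variables); this action extends uniquely to localizations (by $\delta(r/z^m)=(\delta(r/z^{m-1})-[\delta,z](r/z^m))/z$), hence to the Čech complex on $y_i-x_i$, giving the $D_{S|A}$-module structure on $H^{d+1}_{\Delta_{S|A}}(P_{S|A})$.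 The classes $[\,\cdot\,]$ are elements of top local cohomology computed by the Čech complex on $y_0-x_0,\dots,y_d-x_d$. *)

(* Defs.v *)
From HB Require Import structures.
From mathcomp Require Import all_boot all_order all_algebra.
From mathcomp Require Import mpoly.
Set Implicit Arguments. Unset Strict Implicit. Unset Printing Implicit Defensive.
Import Order.TTheory GRing.Theory.
Local Open Scope ring_scope.

Section Defs.
Variables (A : comNzRingType) (d : nat).

Definition Sring := {mpoly A[d.+1]}.
(* P_{S|A} = S (x)_A S = A[x,y], realised as S[y_0,...,y_d]:
   x_i = ('X_i)%:MP  (= x_i (x) 1),  y_i = 'X_i  (= 1 (x) x_i). *)
Definition Pring := {mpoly Sring[d.+1]}.

Definition xP (i : 'I_d.+1) : Pring := ('X_i : Sring)%:MP.
Definition yP (i : 'I_d.+1) : Pring := 'X_i.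
Definition gP (i : 'I_d.+1) : Pring := yP i - xP i.
Definition gprod : Pring := \prod_(i < d.+1) gP i.

Definition Alinear (f : Sring -> Sring) : Prop :=
  forall (a : A) (u v : Sring), f (a *: u + v) = a *: f u + f v.

Definition commS (f : Sring -> Sring) (s : Sring) : Sring -> Sring :=
  fun u => f (s * u) - s * f u.

Fixpoint isDiffOpOrd (n : nat) (f : Sring -> Sring) : Prop :=
  match n with
  | 0 => Alinear f /\ forall s u : Sring, f (s * u) = s * f u
  | k.+1 => Alinear f /\ forall s : Sring, isDiffOpOrd k (commS f s)
  end.

Definition isDiffOp (f : Sring -> Sring) : Prop := exists n, isDiffOpOrd n f.

Definition dpartial (a : 'X_{1..d.+1}) (f : Sring) : Sring :=
  \sum_(b <- msupp f)
     (f@_b * (\prod_(i < d.+1) ('C(b i, a i))%:R)) *: 'X_[(b - a)%MM].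

(* P-module structure on D: (s1 (x) s2) . delta = s1 o delta o s2 ;
   for p = sum_b c_b y^b, p . delta = sum_b c_b o delta o x^b. *)
Definition Pact (p : Pring) (f : Sring -> Sring) : Sring -> Sring :=
  fun u => \sum_(b <- msupp p) p@_b * f ('X_[b] * u).

(* D acts on P via delta |-> delta (x) 1 (on the x variables) *)
Definition tens1 (f : Sring -> Sring) (p : Pring) : Pring :=
  \sum_(b <- msupp p) (f p@_b)%:MP * 'X_[b].

(* (r, m) represents r / prod_i (y_i - x_i)^(m_i) *)
Definition lfrac := (Pring * 'X_{1..d.+1})%type.

Definition gpow (m : 'X_{1..d.+1}) : Pring := \prod_(i < d.+1) gP i ^+ m i.

Definition feq (f f' : lfrac) : Prop :=
  exists K : nat, gprod ^+ K * (f.1 * gpow f'.2 - f'.1 * gpow f.2) = 0.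

Definition fadd (f f' : lfrac) : lfrac :=
  (f.1 * gpow f'.2 + f'.1 * gpow f.2, (f.2 + f'.2)%MM).
Definition fsub (f f' : lfrac) : lfrac :=
  (f.1 * gpow f'.2 - f'.1 * gpow f.2, (f.2 + f'.2)%MM).
Definition fscale (p : Pring) (f : lfrac) : lfrac := (p * f.1, f.2).

(* the class of f in H^{d+1} = P_{g_0...g_d} / sum_i Im(P_{g_0..^g_i..g_d})
   is zero iff f = sum_i s_i / (prod_{j<>i} g_j)^n = sum_i s_i g_i^n / g^n *)
Definition zeroH (f : lfrac) : Prop :=
  exists (n : nat) (s : 'I_d.+1 -> Pring),
    feq f (\sum_(i < d.+1) s i * gP i ^+ n, [multinom n | i < d.+1]).

Definition sameH (f f' : lfrac) : Prop := zeroH (fsub f f').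

Definition adg (E : Pring -> Pring) : Pring -> Pring :=
  fun p => E (gprod * p) - gprod * E p.

Definition locOp (E : Pring -> Pring) : Prop :=
  (forall p q, E (p + q) = E p + E q) /\
  exists k, forall p, iter k adg E p = 0.

(* ext is "the" extension of operators to P_g, characterized as in the
   paper by  E(1-fraction) = E,  E(g f) = g E(f) + [E,g](f)  (equivalently
   E(r/g^m) = (E(r/g^{m-1}) - [E,g](r/g^m))/g), compatibly with the
   equality of fractions and additively in E. *)
Definition isLocExt (ext : (Pring -> Pring) -> lfrac -> lfrac) : Prop :=
  forall E, locOp E ->
    [/\ forall f f', feq f f' -> feq (ext E f) (ext E f'),
        forall r, feq (ext E (r, 0%MM)) (E r, 0%MM),
        forall f, feq (ext E (fscale gprod f))
                      (fadd (fscale gprod (ext E f)) (ext (adg E) f)) &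
        forall E', locOp E' -> forall f,
          feq (ext (fun p => E p + E' p) f) (fadd (ext E f) (ext E' f))].

End Defs.

(* Main.v *)
Require Import Defs.
From HB Require Import structures.
From mathcomp Require Import all_boot all_order all_algebra.
From mathcomp Require Import mpoly.
From mathcomp Require Import ring.
From Stdlib Require Import FunctionalExtensionality Setoid Morphisms.
Import GRing.Theory.
Local Open Scope ring_scope.
Set Implicit Arguments.
Unset Strict Implicit.
Unset Printing Implicit Defensive.

(* Write z_i = y_i - x_i.  Multiplication by gprod is invertible on fractions, so
   an operator identity holds for the extension to fractions as soon as it holds
   on polynomials (ext_unique); in particular the extension is additive and
   satisfies E(p f) = p E(f) + [E, p](f) for every p.

   The defect Theta (delta f) - delta o Theta f is y-linear in f, and x-linear by
   induction on the order of delta, so only f = 1 / z^m matters.  Since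
   [delta (x) 1, z_i] = - [delta, x_i] (x) 1, induction gives
     delta (1 / z^m) = delta(1) / z^m + (S-combination of 1 / z^(m + c), c <> 0).
   Evaluated at u = 1, Theta sends s / z^(a + 1) to s if a = 0 and to 0 otherwise,
   so only the leading term survives and the defect vanishes at 1.  Other values
   of u are reached by y-linearity and y_i = x_i + z_i, as z_i lowers m. *)

Lemma eq_subr0 (V : zmodType) (x y : V) : x = y -> x - y = 0.
Proof. by move=> ->; rewrite subrr. Qed.

(** * Commutators of operators with multiplications *)

Section Commutators.
Variable R : comNzRingType.
Implicit Types (p q : R) (E : R -> R).

Definition ad p E : R -> R := fun q => E (p * q) - p * E q.

Definition op0 : R -> R := fun _ => 0.

Lemma ad0 p : ad p op0 = op0.
Proof. by apply: functional_extensionality => q; rewrite /ad /op0 mulr0 subrr. Qed.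

Lemma adC p q E : ad p (ad q E) = ad q (ad p E).
Proof. by apply: functional_extensionality => r; rewrite /ad (mulrCA p q r); ring. Qed.

Lemma ad_add p E : {morph E : x y / x + y} -> {morph (ad p E) : x y / x + y}.
Proof. by move=> aE x y; rewrite /ad mulrDr !aE; ring. Qed.

Lemma iter_adC k q p E : iter k (ad q) (ad p E) = ad p (iter k (ad q) E).
Proof. by elim: k => //= k ->; exact: adC. Qed.

End Commutators.

(** * Induction on exponent vectors *)

Lemma mnm_neq0P n (m : 'X_{1..n}) : m != 0%MM -> exists i, m i != 0%N.
Proof.
move=> m0; apply/existsP; apply: contraR m0; rewrite negb_exists => /forallP H.
by apply/eqP/mnmP => i; rewrite mnm0E; apply/eqP; move/negbNE: (H i).
Qed.

Lemma mnm_U_decomp n (m : 'X_{1..n}) i : m i != 0%N -> m = (U_(i) + (m - U_(i)))%MM.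
Proof.
move=> mi; apply/mnmP => j; rewrite mnmDE mnmBE mnm1E.
by case: eqP => [<-|_]; rewrite ?subn0 // subnKC // lt0n.
Qed.

Lemma mnm_ind n (Q : 'X_{1..n} -> Prop) :
  Q 0%MM -> (forall i m, Q m -> Q (U_(i) + m)%MM) -> forall m, Q m.
Proof.
move=> Q0 QS m; move: {2}(mdeg m) (erefl (mdeg m)) => k.
elim: k m => [|k IH] m; first by move/eqP; rewrite mdeg_eq0 => /eqP ->.
have [->//|/mnm_neq0P [i /mnm_U_decomp ->]] := eqVneq m 0%MM.
by rewrite mdegD mdeg1 => -[/IH]; exact: QS.
Qed.

Lemma morph_add0 (V : zmodType) (D : V -> V) : {morph D : x y / x + y} -> D 0 = 0.
Proof. by move=> aD; apply: (addrI (D 0)); rewrite -aD !addr0. Qed.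

(** * Order of an operator, measured by iterated commutators *)

Section CommutatorOrder.
Variable R : comNzRingType.
Implicit Types (p q : R) (E : R -> R).

(** Level 0 is the zero operator rather than linearity over the ring, so indices exceed those of
    [isDiffOpOrd] by one. *)
Fixpoint commord n E : Prop :=
  if n is k.+1 then forall p, commord k (ad p E) else E = @op0 R.

Lemma commord_op0 n : commord n (@op0 R).
Proof. by elim: n => //= n IH p; rewrite ad0. Qed.

Lemma commord_add n E E' :
  commord n E -> commord n E' -> commord n (fun q => E q + E' q).
Proof.
elim: n E E' => [|n IH] E E' /=.
  by move=> -> ->; apply: functional_extensionality => q; rewrite /op0 addr0.
move=> HE HE' p; have := IH _ _ (HE p) (HE' p).
by congr commord; apply: functional_extensionality => q; rewrite /ad; ring.
Qed.

Lemma commord_mul n p E : commord n E -> commord n (fun q => p * E q).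
Proof.
elim: n E => [|n IH] E /=.
  by move=> ->; apply: functional_extensionality => q; rewrite /op0 mulr0.
move=> HE q; have := IH _ (HE q).
by congr commord; apply: functional_extensionality => r; rewrite /ad; ring.
Qed.

Lemma commord_iter n p E : commord n E -> iter n (ad p) E = @op0 R.
Proof. by elim: n E => //= n IH E HE; rewrite -iterS iterSr; exact: IH. Qed.

End CommutatorOrder.

(** * Operators acting on the coefficients of polynomials *)

Section TensorOperator.
Variables (R : comNzRingType) (n : nat).
Implicit Types (D : R -> R) (p q : {mpoly R[n]}).

(** This is [tens1] over an arbitrary coefficient ring; over [Sring] the two are convertible, which
    the final theorem relies on. *)
Definition tens D p : {mpoly R[n]} := \sum_(b <- msupp p) (D p@_b)%:MP * 'X_[b].

Lemma mcoeff_tens D p b : D 0 = 0 -> (tens D p)@_b = D p@_b.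
Proof.
move=> D0; rewrite /tens raddf_sum /=.
under eq_bigr => c _ do rewrite mcoeffCM mcoeffX.
have [bp|bp] := boolP (b \in msupp p).
  rewrite (bigD1_seq b) //= eqxx mulr1 big1 ?addr0 // => c /negbTE ->.
  by rewrite mulr0.
rewrite (memN_msupp_eq0 bp) D0 big_seq big1 // => c cp.
by case: eqP bp => [<-|_]; rewrite ?cp ?mulr0.
Qed.

Lemma mcoeffXM p b k :
  ('X_[b] * p)@_k = if (b <= k)%MM then p@_(k - b) else 0.
Proof.
case: ifP => [bk|/negP bk].
  by rewrite -{1}(submK bk) addmC mulrC mcoeffMX.
rewrite mulrC {1}[p]mpolyE mulr_suml raddf_sum /= big1 // => c _.
rewrite -scalerAl -mpolyXD mcoeffZ mcoeffX; case: eqP; rewrite ?mulr0 // => E.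
by case: bk; rewrite -E; apply/mnm_lepP => i; rewrite mnmDE leq_addl.
Qed.

Lemma tens_add D : {morph D : x y / x + y} -> {morph (tens D) : p q / p + q}.
Proof.
move=> aD p q; apply/mpolyP => b.
by rewrite mcoeffD !mcoeff_tens ?morph_add0 // mcoeffD aD.
Qed.

Lemma tens_op0 : tens (@op0 R) = @op0 _.
Proof.
by apply: functional_extensionality => p; rewrite /tens big1 // => b _; rewrite mul0r.
Qed.

Lemma tensC D c : D 0 = 0 -> tens D c%:MP = (D c)%:MP.
Proof.
move=> D0; apply/mpolyP => b; rewrite mcoeff_tens // !mcoeffC.
by case: eqP; rewrite ?mulr1 // !mulr0.
Qed.

Lemma ad_tensC D c : D 0 = 0 -> ad c%:MP (tens D) = tens (ad c D).
Proof.
move=> D0; apply: functional_extensionality => p; apply/mpolyP => b.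
by rewrite /ad mcoeffB mcoeffCM !mcoeff_tens ?mcoeffCM // mulr0 D0 mulr0 subrr.
Qed.

(** [tens D] changes only coefficients, whereas a monomial only shifts exponents. *)
Lemma ad_tensX D b : D 0 = 0 -> ad 'X_[b] (tens D) = @op0 _.
Proof.
move=> D0; apply: functional_extensionality => p; apply/mpolyP => k.
rewrite /ad mcoeffB mcoeffXM !mcoeff_tens // mcoeffXM.
by case: ifP; rewrite ?D0 subrr mcoeff0.
Qed.

Lemma ad_tensCX D c b :
  D 0 = 0 -> ad (c *: 'X_[b]) (tens D) = fun p => 'X_[b] * tens (ad c D) p.
Proof.
move=> D0; apply: functional_extensionality => p; rewrite -ad_tensC //.
have := congr1 (fun F => F (c%:MP * p)) (ad_tensX b D0).
rewrite /ad /op0 -mul_mpolyC => /subr0_eq H.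
rewrite mulrBr -H; congr (tens D _ - _); ring.
Qed.

(** Monomials commute with [tens D], so only the constant contributes. For [c] the variable x_i this
    is the commutator with z_i. *)
Lemma ad_tensXC D c b : {morph D : x y / x + y} ->
  ad ('X_[b] - c%:MP) (tens D) = tens (ad (- c) D).
Proof.
move=> aD; have D0 := morph_add0 aD; have aT := tens_add aD.
have T0 := morph_add0 aT.
apply: functional_extensionality => p; rewrite -ad_tensC //.
have := congr1 (fun F => F p) (ad_tensX b D0).
by rewrite /ad /op0 => /subr0_eq H; rewrite mulrDl aT H mpolyCN; ring.
Qed.

(** The commutator is additive in the multiplier, so terms c y^b suffice; [ad_tensCX] turns these
    into y^b times [tens] of an operator of smaller order. *)
Lemma commord_tens k D :
  {morph D : x y / x + y} -> commord k D -> commord k (tens D).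
Proof.
elim: k D => [|k IH] D aD; first by move=> /= ->; exact: tens_op0.
have aT := tens_add aD; have T0 := morph_add0 aT.
move=> HD p; elim/mpolyind: p => [|c b p _ _ Hp].
  suff -> : ad 0 (tens D) = @op0 _ by exact: commord_op0.
  by apply: functional_extensionality => q; rewrite /ad !mul0r T0 subrr.
have := commord_add (commord_mul 'X_[b] (IH _ (ad_add c aD) (HD c))) Hp.
congr commord; apply: functional_extensionality => q.
rewrite -(congr1 (fun F => F q) (ad_tensCX c b (morph_add0 aD))) /ad mulrDl aT.
by rewrite mulrDl opprD addrACA.
Qed.

End TensorOperator.
Section Theory.
Variables (A : comNzRingType) (d : nat).
Notation S := (Sring A d).
Notation P := (Pring A d).
Notation frac := (lfrac A d).
Notation mon := ('X_{1..d.+1}).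
Implicit Types (f : frac) (m : mon).

Local Notation gpow := (@gpow A d).
Local Notation gprod := (@gprod A d).
Local Notation gP := (@gP A d).

(** * Calculus of fractions with denominators z^m *)

Lemma gpowD m m' : gpow (m + m')%MM = gpow m * gpow m'.
Proof. by rewrite -big_split /=; apply: eq_bigr => i _; rewrite mnmDE exprD. Qed.

Lemma gpow0 : gpow 0%MM = 1.
Proof. by rewrite /gpow big1 // => i _; rewrite mnm0E. Qed.

Lemma gpowU i : gpow U_(i)%MM = gP i.
Proof.
rewrite /gpow (bigD1 i) //= mnm1E eqxx big1 ?mulr1 // => j /negbTE ji.
by rewrite mnm1E eq_sym ji.
Qed.

Lemma gpow_const n : gpow [multinom n | i < d.+1] = gprod ^+ n.
Proof. by rewrite -prodrXl; apply: eq_bigr => i _; rewrite mnmE. Qed.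

(** The subtraction is truncated, so [n] has to bound every entry of [m]; [mdeg m] is such a
    bound. *)
Definition mcompl (n : nat) (m : mon) : mon := [multinom (n - m i)%N | i < d.+1].

Lemma mcomplK n m : (mdeg m <= n)%N -> gpow (mcompl n m) * gpow m = gprod ^+ n.
Proof.
move=> mn; rewrite -gpowD -gpow_const; congr (gpow _); apply/mnmP => i.
rewrite mnmDE !mnmE subnK // (leq_trans _ mn) // mdegE (bigD1 i) //=.
exact: leq_addr.
Qed.

(** Every z^m divides a power of [gprod], so any [gpow m] may serve as multiplier; multipliers then
    combine by adding exponents. *)
Lemma feqP f f' :
  feq f f' <-> exists m, gpow m * (f.1 * gpow f'.2) = gpow m * (f'.1 * gpow f.2).
Proof.
split=> [[K]|[m]] H.
  exists [multinom K | i < d.+1]; apply/eqP; rewrite gpow_const -subr_eq0 -mulrBr.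
  by rewrite H.
exists (mdeg m); rewrite -(mcomplK (leqnn _)) mulrBr -!mulrA H.
by rewrite subrr.
Qed.

Lemma feq_refl f : feq f f.
Proof. by apply/feqP; exists 0%MM. Qed.

Lemma feq_sym f f' : feq f f' -> feq f' f.
Proof. by move/feqP => [m H]; apply/feqP; exists m; exact: esym H. Qed.

Lemma feq_trans f f' f'' : feq f f' -> feq f' f'' -> feq f f''.
Proof.
(* The middle denominator remains as a common factor when the two equations are chained, so it joins
   the multiplier. *)
move=> /feqP [m H] /feqP [m' H']; apply/feqP; exists (m + m' + f'.2)%MM.
rewrite !gpowD.
transitivity (gpow m * (f.1 * gpow f'.2) * (gpow m' * gpow f''.2)); first by ring.
rewrite H.
transitivity (gpow m' * (f'.1 * gpow f''.2) * (gpow m * gpow f.2)); first by ring.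
by rewrite H'; ring.
Qed.

#[local] Instance feq_Equivalence : Equivalence (@feq A d).
Proof. by split; [exact: feq_refl|exact: feq_sym|exact: feq_trans]. Qed.

#[local] Instance fadd_Proper :
  Proper (@feq A d ==> @feq A d ==> @feq A d) (@fadd A d).
Proof.
move=> a a' /feqP [m H] b b' /feqP [n K]; apply/feqP; exists (m + n)%MM.
rewrite /fadd /= !gpowD.
transitivity (gpow m * (a.1 * gpow a'.2) * (gpow n * gpow b.2 * gpow b'.2) +
  gpow n * (b.1 * gpow b'.2) * (gpow m * gpow a.2 * gpow a'.2)); first by ring.
by rewrite H K; ring.
Qed.

#[local] Instance fscale_Proper p : Proper (@feq A d ==> @feq A d) (@fscale A d p).
Proof.
move=> a a' /feqP [m H]; apply/feqP; exists m; rewrite /fscale /=.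
transitivity (p * (gpow m * (a.1 * gpow a'.2))); first by ring.
by rewrite H; ring.
Qed.

Lemma feq_eq f f' : f.1 * gpow f'.2 = f'.1 * gpow f.2 -> feq f f'.
Proof. by move=> H; apply/feqP; exists 0%MM; rewrite H. Qed.

Lemma faddC (a b : frac) : feq (fadd a b) (fadd b a).
Proof. by apply: feq_eq; rewrite /= !gpowD; ring. Qed.

Lemma faddA (a b c : frac) : feq (fadd a (fadd b c)) (fadd (fadd a b) c).
Proof. by apply: feq_eq; rewrite /= !gpowD; ring. Qed.

Lemma faddACA (a b c e : frac) :
  feq (fadd (fadd a b) (fadd c e)) (fadd (fadd a c) (fadd b e)).
Proof. by apply: feq_eq; rewrite /= !gpowD; ring. Qed.

Lemma fscaleD p (a b : frac) : feq (fscale p (fadd a b)) (fadd (fscale p a) (fscale p b)).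
Proof. by apply: feq_eq; rewrite /= !gpowD; ring. Qed.

Lemma fscaleC p q (f : frac) : fscale p (fscale q f) = fscale q (fscale p f).
Proof. exact: (congr1 (fun t => (t, f.2)) (mulrCA p q f.1)). Qed.

Lemma faddr0 f : feq (fadd f (0, 0%MM)) f.
Proof. by case: f => r m; apply: feq_eq; rewrite /= !gpowD gpow0; ring. Qed.

Lemma fadd_same (r r' : P) m : feq (fadd (r, m) (r', m)) (r + r', m).
Proof. by apply: feq_eq; rewrite /= !gpowD; ring. Qed.

Lemma fadd_cancel m (a b x : frac) :
  feq (fadd (fscale (gpow m) a) x) (fadd (fscale (gpow m) b) x) -> feq a b.
Proof.
move=> /feqP [n]; rewrite /fadd /fscale /= !gpowD => /eq_subr0 H.
apply/feqP; exists (n + m + x.2 + x.2)%MM; rewrite !gpowD; apply: subr0_eq.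
by apply: etrans H; ring.
Qed.

Lemma fadd_idem f : feq f (fadd f f) -> feq f (0, 0%MM).
Proof.
move=> /feqP [n]; rewrite /= !gpowD => /esym /eq_subr0 H.
apply/feqP; exists (n + f.2 + f.2)%MM; rewrite !gpowD gpow0 /=; apply: subr0_eq.
by apply: etrans H; ring.
Qed.

Lemma fscale_clear f : exists n r, feq (iter n (fscale gprod) f) (r, 0%MM).
Proof.
case: f => r m; exists (mdeg m), (r * gpow (mcompl (mdeg m) m)).
have -> n : iter n (fscale gprod) (r, m) = (gprod ^+ n * r, m).
  by elim: n => [|n IH] /=; rewrite ?mul1r // IH /fscale /= exprS mulrA.
by apply: feq_eq; rewrite /= gpow0 -(mcomplK (leqnn _)); ring.
Qed.

Local Notation op0 := (@op0 P).

Lemma adgE : @adg A d = ad gprod. Proof. by []. Qed.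

Lemma locOp0 : @locOp A d op0.
Proof. by split=> [p q|]; [rewrite addr0|exists 0%N]. Qed.

(** Commutators with [p] and with [gprod] commute, so the nilpotency bound [k] carries over. *)
Lemma locOp_ad (p : P) (E : P -> P) : locOp E -> locOp (ad p E).
Proof.
move=> [aE [k Ek]]; split; first exact: ad_add.
exists k => q; move: Ek; rewrite adgE iter_adC => Ek.
have -> : iter k (ad gprod) E = op0 by apply: functional_extensionality.
by rewrite ad0.
Qed.

(** * Consequences of the axioms for the extension to fractions *)

Section Extension.
Variable ext : (P -> P) -> frac -> frac.
Hypothesis ext_loc : isLocExt ext.

#[local] Instance ext_Proper E (lE : locOp E) : Proper (@feq A d ==> @feq A d) (ext E).
Proof. by move=> f f' ff'; case: (ext_loc lE) => H _ _ _; exact: H. Qed.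

Lemma ext_feq E f f' : locOp E -> feq f f' -> feq (ext E f) (ext E f').
Proof. by move=> lE; exact: ext_Proper. Qed.

Lemma ext_poly E r : locOp E -> feq (ext E (r, 0%MM)) (E r, 0%MM).
Proof. by move=> lE; case: (ext_loc lE) => _ H _ _; exact: H. Qed.

Lemma ext_gprod E f : locOp E ->
  feq (ext E (fscale gprod f)) (fadd (fscale gprod (ext E f)) (ext (adg E) f)).
Proof. by move=> lE; case: (ext_loc lE) => _ _ H _; exact: H. Qed.

(** Additivity in the operator, applied to 0 + 0 = 0, makes the value equal to its own double. *)
Lemma ext_op0 f : feq (ext op0 f) (0, 0%MM).
Proof.
apply: fadd_idem; case: (ext_loc locOp0) => _ _ _ /(_ _ locOp0 f).
suff -> : (fun p => op0 p + op0 p) = op0 by [].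
by apply: functional_extensionality => p; rewrite /op0 addr0.
Qed.

(* The order of an operator with respect to gprod and the power of gprod that
   clears the denominators both drop when one multiplies by gprod, which is
   invertible on fractions. *)
Lemma ext_unique (I : Type) (gI : I -> I) (L1 L2 : (P -> P) -> I -> frac) :
  (forall E i, locOp E ->
     feq (L1 E (gI i)) (fadd (fscale gprod (L1 E i)) (L1 (adg E) i))) ->
  (forall E i, locOp E ->
     feq (L2 E (gI i)) (fadd (fscale gprod (L2 E i)) (L2 (adg E) i))) ->
  (forall i, feq (L1 op0 i) (L2 op0 i)) ->
  (forall i, exists n, forall E, locOp E ->
     feq (L1 E (iter n gI i)) (L2 E (iter n gI i))) ->
  forall E i, locOp E -> feq (L1 E i) (L2 E i).
Proof.
move=> H1 H2 H0 Hb E i lE; have [_ [k]] := lE.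
elim: k E i lE => [|k IHk] E i lE Ek.
  by have -> : E = op0 by exact: functional_extensionality.
have {IHk} IHk j : feq (L1 (adg E) j) (L2 (adg E) j).
  apply: IHk => [|p]; first exact: locOp_ad.
  by rewrite -iterSr.
have [n] := Hb i; elim: n i => [|n IHn] i Hi; first exact: Hi.
have {IHn} Hg : feq (L1 E (gI i)) (L2 E (gI i)).
  by apply: IHn => E' lE'; rewrite -iterSr; exact: Hi.
move: Hg; rewrite (H1 _ _ lE) (H2 _ _ lE) (IHk i).
rewrite -[gprod]expr1 -gpow_const; exact: fadd_cancel.
Qed.

(** By [adC] both sides obey the recursion of [ext_unique]; on polynomials the identity is the
    definition of [ad]. *)
Lemma ext_fscale E p f : locOp E ->
  feq (ext E (fscale p f)) (fadd (fscale p (ext E f)) (ext (ad p E) f)).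
Proof.
move: E f; apply: (@ext_unique _ (fscale gprod) (fun E f => ext E (fscale p f))
  (fun E f => fadd (fscale p (ext E f)) (ext (ad p E) f))).
- by move=> E f lE; rewrite (fscaleC p); exact: ext_gprod.
- move=> E f lE; rewrite (ext_gprod _ lE) (ext_gprod _ (locOp_ad p lE)).
  rewrite !fscaleD (fscaleC p gprod) !adgE (adC p gprod); exact: faddACA.
- move=> f; rewrite ad0 !ext_op0.
  by apply: feq_eq; rewrite /= !gpowD gpow0; ring.
- move=> f; have [n [r Hn]] := fscale_clear f; exists n => E lE.
  have lE' := locOp_ad p lE.
  rewrite (ext_feq lE (fscale_Proper p Hn)) (ext_feq lE Hn) (ext_feq lE' Hn).
  rewrite (ext_poly (p * r) lE) (ext_poly r lE) (ext_poly r lE').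
  by rewrite -{1}(subrK (p * E r) (E (p * r))) addrC; symmetry; exact: fadd_same.
Qed.

Lemma ext_add E r r' m : locOp E ->
  feq (ext E (r + r', m)) (fadd (ext E (r, m)) (ext E (r', m))).
Proof.
(* The index is a pair of numerators over a common denominator, and [gprod] multiplies both at
   once. *)
move=> lE; pose gI (t : P * P * mon) := (gprod * t.1.1, gprod * t.1.2, t.2).
apply: (@ext_unique _ gI (fun E t => ext E (t.1.1 + t.1.2, t.2))
  (fun E t => fadd (ext E (t.1.1, t.2)) (ext E (t.1.2, t.2))) _ _ _ _ E (r, r', m)).
- move=> {}E [[u v] n] {}lE; rewrite /= -mulrDr; exact: (ext_gprod (u + v, n) lE).
- move=> {}E [[u v] n] {}lE /=.
  rewrite (ext_gprod (u, n) lE) (ext_gprod (v, n) lE).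
  rewrite fscaleD; exact: faddACA.
- by move=> t; rewrite !ext_op0 faddr0; exact: feq_refl.
- move=> [[u v] n]; exists (mdeg n) => {}E {}lE.
  have -> : iter (mdeg n) gI (u, v, n) = (gprod ^+ mdeg n * u, gprod ^+ mdeg n * v, n).
    by elim: (mdeg n) => [|k IH]; rewrite ?expr0 ?mul1r //= IH /gI /= exprS !mulrA.
  set c := gpow (mcompl (mdeg n) n).
  have Hc w : feq (gprod ^+ mdeg n * w, n) (w * c, 0%MM).
    by apply: feq_eq; rewrite /= gpow0 -(mcomplK (leqnn _)); rewrite -/c; ring.
  rewrite /= -mulrDr !(ext_feq lE (Hc _)) !(ext_poly _ lE) mulrDl lE.1.
  by symmetry; exact: fadd_same.
- exact: lE.
Qed.

(** * Division by z_i and terms with higher poles *)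

Definition divz i f : frac := (f.1, (U_(i) + f.2)%MM).

Lemma divz_feq i f f' : feq f f' -> feq (divz i f) (divz i f').
Proof.
move=> /feqP [m H]; apply/feqP; exists m; rewrite /= !gpowD.
transitivity (gpow U_(i) * (gpow m * (f.1 * gpow f'.2))); first by ring.
by rewrite H; ring.
Qed.

#[local] Instance divz_Proper i : Proper (@feq A d ==> @feq A d) (divz i).
Proof. by move=> f f'; exact: divz_feq. Qed.

Lemma divz_add i (a b : frac) : feq (divz i (fadd a b)) (fadd (divz i a) (divz i b)).
Proof. by apply: feq_eq; rewrite /= !gpowD; ring. Qed.

Lemma divzK i f : feq (divz i (fscale (gP i) f)) f.
Proof. by apply: feq_eq; rewrite /= !gpowD gpowU; ring. Qed.

Lemma fscale_gP_divz i r m : feq (fscale (gP i) (r, (U_(i) + m)%MM)) (r, m).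
Proof. by apply: feq_eq; rewrite /= !gpowD gpowU; ring. Qed.

Lemma fadd_move (x a b : frac) : feq x (fadd a b) -> feq a (fadd x (fscale (-1) b)).
Proof.
by move=> ->; apply: feq_eq; rewrite /= !gpowD; ring.
Qed.

(* The S-span of the fractions 1 / z^(m + c) with c nonzero and supported in
   the support of m, where z_i = y_i - x_i. *)
Inductive lower_span m : frac -> Prop :=
| LowerFeq f f' : feq f f' -> lower_span m f -> lower_span m f'
| Lower0 : lower_span m (0, 0%MM)
| LowerAdd f f' : lower_span m f -> lower_span m f' -> lower_span m (fadd f f')
| LowerGen (s : S) (c : mon) : c != 0%MM -> (forall i, m i = 0%N -> c i = 0%N) ->
    lower_span m (s%:MP, (m + c)%MM).

Lemma lower_span_opp m f : lower_span m f -> lower_span m (fscale (-1) f).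
Proof.
elim=> [{}f f' ff' _ IH||{}f f' _ IH _ IH'|s c c0 mc].
- by apply: LowerFeq IH; exact: fscale_Proper.
- by apply: LowerFeq (Lower0 m); apply: feq_eq; rewrite /= mulr0.
- by apply: LowerFeq (LowerAdd IH IH'); symmetry; exact: fscaleD.
- have := LowerGen (- s) c0 mc; congr lower_span.
  by rewrite /fscale /= mpolyCN mulN1r.
Qed.

(** The condition on exponents stays abstract because the new factor z_i may go either into the
    reference exponent or into [c]. *)
Lemma lower_span_divz m m' i f :
  (forall c, c != 0%MM -> (forall j, m j = 0%N -> c j = 0%N) ->
     exists c', [/\ c' != 0%MM, (forall j, m' j = 0%N -> c' j = 0%N)
       & (U_(i) + (m + c))%MM = (m' + c')%MM]) ->
  lower_span m f -> lower_span m' (divz i f).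
Proof.
move=> Hc; elim=> [{}f f' ff' _ IH||{}f f' _ IH _ IH'|s c c0 mc].
- by apply: LowerFeq IH; exact: divz_feq.
- by apply: LowerFeq (Lower0 m'); apply: feq_eq; rewrite /= !mul0r.
- by apply: LowerFeq (LowerAdd IH IH'); symmetry; exact: divz_add.
- by have [c' [c'0 m'c']] := Hc c c0 mc; rewrite /divz /= => ->; exact: LowerGen.
Qed.

Lemma lower_span_divz_raise m i f :
  lower_span m f -> lower_span (U_(i) + m)%MM (divz i f).
Proof.
apply: lower_span_divz => c c0 mc; exists c; split=> // [j|]; last by rewrite addmA.
by rewrite mnmDE => /eqP; rewrite addn_eq0 => /andP [_ /eqP]; exact: mc.
Qed.

Lemma lower_span_divz_stay m i f :
  m i != 0%N -> lower_span m f -> lower_span m (divz i f).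
Proof.
move=> mi; apply: lower_span_divz => c c0 mc; exists (U_(i) + c)%MM; split.
- by rewrite mnmD_eq0 mnm1_eq0.
- move=> j mj; rewrite mnmDE mnm1E mc // addn0.
  by have [ij|//] := eqVneq i j; rewrite ij mj in mi.
- by rewrite !addmA (addmC U_(i)%MM).
Qed.

(** * Leading term of a differential operator applied to 1 / z^m *)

Definition diffop n (D : S -> S) := Alinear D /\ commord n D.

Lemma Alinear_add (D : S -> S) : Alinear D -> {morph D : u v / u + v}.
Proof. by move=> lD u v; have := lD 1 u v; rewrite !scale1r. Qed.

Lemma diffop_comm n D s : diffop n.+1 D -> diffop n (ad s D).
Proof.
move=> [lD HD]; split; last exact: HD.
move=> a u v; rewrite /ad; have -> : s * (a *: u + v) = a *: (s * u) + s * v.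
  by rewrite mulrDr scalerAr.
by rewrite !lD mulrDr -scalerAr opprD addrACA scalerBr.
Qed.

(** For an S-linear operator it is the first commutators that vanish, whence the index [n.+1]. *)
Lemma isDiffOp_diffop D : isDiffOp D -> exists n, diffop n D.
Proof.
move=> [n nD]; exists n.+1; elim: n D nD => [|n IH] D [lD HD]; split=> // s.
  by apply: functional_extensionality => u; rewrite /ad HD subrr.
by have [_] := IH _ (HD s).
Qed.

Lemma locOp_tens n (D : S -> S) : diffop n D -> @locOp A d (tens D).
Proof.
move=> [/Alinear_add aD HD]; split; first exact: tens_add.
exists n => p; rewrite adgE commord_iter //; exact: commord_tens.
Qed.

(** Induction on the order, then on [m], from E(1/z^(m+e_i)) = (E(1/z^m) - [E, z_i](1/z^(m+e_i))) /
    z_i. The commutator has smaller order, and the division gives its leading term an extra pole. *)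
Lemma ext_tens_lead n D m : diffop n D ->
  exists2 F, lower_span m F & feq (ext (tens D) (1, m)) (fadd ((D 1)%:MP, m) F).
Proof.
elim: n D m => [|n IHn] D m nD.
  exists (0, 0%MM); first exact: Lower0.
  case: nD => _ /= ->; rewrite tens_op0 ext_op0.
  by apply: feq_eq; rewrite /= mpolyC0 !mul0r addr0 mul0r.
have lE := locOp_tens nD; have aD := Alinear_add nD.1.
elim/mnm_ind: m => [|i m [F1 HF1 EF1]].
  exists (0, 0%MM); first exact: Lower0.
  rewrite (ext_poly 1 lE) -mpolyC1 tensC ?morph_add0 //; symmetry; exact: faddr0.
pose D' := ad (- 'X_i) D; have nD' : diffop n D' by exact: diffop_comm.
have [F2 HF2 EF2] := IHn D' (U_(i) + m)%MM nD'.
(* In order: the remainder for 1/z^m over z_i, the leading term of the commutator with its excess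
   z_i, and the remainder of the commutator over z_i. *)
exists (fadd (divz i F1) (fadd ((- D' 1)%:MP, (U_(i) + m + U_(i))%MM)
                               (divz i (fscale (-1) F2)))).
  have mi : (U_(i) + m)%MM i != 0%N by rewrite mnmDE mnm1E eqxx.
  apply: LowerAdd; first exact: lower_span_divz_raise.
  apply: LowerAdd; last by apply: lower_span_divz_stay => //; exact: lower_span_opp.
  apply: LowerGen; first by rewrite mnm1_eq0.
  by move=> j; rewrite mnmDE mnm1E; case: eqP.
have adE : ad (gP i) (tens D) = tens D' by exact: ad_tensXC.
have := fadd_move (ext_fscale (gP i) (1, (U_(i) + m)%MM) lE).
rewrite adE => /(divz_feq i) H.
apply: feq_trans (feq_trans (feq_sym (divzK i _)) H) _ => {H}.
have H1 := feq_trans (ext_feq lE (fscale_gP_divz i 1 m)) EF1.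
apply: feq_trans (divz_feq i (fadd_Proper H1 (fscale_Proper (-1) EF2))) _.
rewrite !divz_add fscaleD divz_add.
have -> : divz i ((D 1)%:MP, m) = ((D 1)%:MP, (U_(i) + m)%MM).
  exact: erefl.
have -> : divz i (fscale (-1) ((D' 1)%:MP, (U_(i) + m)%MM)) =
  ((- D' 1)%:MP, (U_(i) + m + U_(i))%MM).
  by rewrite /divz /fscale /= mpolyCN mulN1r [(U_(i) + m + _)%MM]addmC.
by symmetry; exact: faddA.
Qed.

(** * Values at 1 and vanishing classes in local cohomology *)

Lemma dpartial1 (a : mon) : dpartial a 1 = (a == 0%MM)%:R :> S.
Proof.
rewrite /dpartial -mpolyC1 msupp1 big_seq1 mcoeffC eqxx !mul1r.
have [->|/mnm_neq0P [i ai]] := eqVneq a 0%MM.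
  rewrite subm0 mpolyX0 big1 ?scale1r // => i _.
  by rewrite mnm0E bin0.
rewrite (bigD1 i) //= mnm0E bin0n (negbTE ai) mul0r; exact: scale0r.
Qed.

(** A fraction without a pole along z_i comes from the Cech term that omits z_i. *)
Lemma zeroH_holomorphic (r : P) m i : m i = 0%N -> zeroH (r, m).
Proof.
move=> mi; set n := mdeg m.
pose c := \prod_(k < d.+1 | k != i) gP k ^+ (n - m k).
(* Only the summand at [i] is nonzero: [c] raises the other denominators to exponent [n], and z_i^n
   itself is the factor supplied by the sum, as m_i = 0. *)
exists n, (fun j => if j == i then r * c else 0).
have -> : \sum_(j < d.+1) (if j == i then r * c else 0) * gP j ^+ n =
          r * gpow (mcompl n m).
  rewrite (bigD1 i) //= eqxx big1 ?addr0; last by move=> j /negbTE ->; rewrite mul0r.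
  rewrite -mulrA; congr (_ * _).
  rewrite /Defs.gpow (bigD1 i) //= mnmE mi subn0 mulrC; congr (_ * _).
  by apply: eq_bigr => j _; rewrite mnmE.
by apply: feq_eq; rewrite /= gpow_const -(mcomplK (leqnn _)) mulrA.
Qed.

Lemma feq_sameH f f' : feq f f' -> sameH f f'.
Proof.
move=> /feqP [m H]; exists 0%N, (fun=> 0); apply/feqP; exists m.
rewrite /= big1 => [|i _]; last by rewrite mul0r.
by rewrite mul0r mulr0 mulrA mulrBr H subrr mul0r.
Qed.

Lemma PactC (s : S) (F : S -> S) u : Pact s%:MP F u = s * F u.
Proof.
rewrite /Pact msuppC; case: eqP => [->|_]; first by rewrite big_nil mul0r.
by rewrite big_seq1 mcoeffC eqxx mulr1 mpolyX0 mul1r.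
Qed.

Lemma PactX (b : mon) (F : S -> S) u : Pact ('X_[b] : P) F u = F ('X_[b] * u).
Proof. by rewrite /Pact msuppX big_seq1 mcoeffX eqxx mul1r. Qed.

(** * Values of [Theta] on fractions *)

Section Residue.
Variable Theta : frac -> S -> S.
Hypothesis Theta_sameH : forall f f', sameH f f' -> forall u, Theta f u = Theta f' u.
Hypothesis Theta_diff : forall f, isDiffOp (Theta f).
Hypothesis Theta_add :
  forall r r' m u, Theta (r + r', m) u = Theta (r, m) u + Theta (r', m) u.
Hypothesis Theta_scale : forall (p : P) f u, Theta (fscale p f) u = Pact p (Theta f) u.
Hypothesis Theta_gen : forall (a : mon) u,
  Theta (1, [multinom (a i).+1 | i < d.+1]) u = dpartial a u.

Lemma Theta_feq f f' u : feq f f' -> Theta f u = Theta f' u.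
Proof. by move=> /feq_sameH /Theta_sameH. Qed.

Lemma Theta_zero m u : Theta (0, m) u = 0.
Proof. by apply: (addrI (Theta (0, m) u)); rewrite -Theta_add !addr0. Qed.

Lemma Theta_fadd f f' u : Theta (fadd f f') u = Theta f u + Theta f' u.
Proof.
rewrite /fadd Theta_add; congr (_ + _); apply: Theta_feq; apply: feq_eq;
  by rewrite /= gpowD; ring.
Qed.

Lemma Theta_C (s : S) f u : Theta (fscale s%:MP f) u = s * Theta f u.
Proof. by rewrite Theta_scale PactC. Qed.

Lemma Theta_X b f u : Theta (fscale 'X_[b] f) u = Theta f ('X_[b] * u).
Proof. by rewrite Theta_scale PactX. Qed.

Lemma Theta_holomorphic r m i u : m i = 0%N -> Theta (r, m) u = 0.
Proof.
move=> mi; rewrite -(Theta_zero m u); apply: Theta_sameH.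
by apply: (@zeroH_holomorphic _ _ i); rewrite mnmDE mi.
Qed.

(** The generators carry exponents a + 1; the predecessors are genuine because no entry of [m]
    vanishes. *)
Lemma Theta_pole s m u : (forall i, m i != 0%N) ->
  Theta (s%:MP, m) u = s * dpartial [multinom (m i).-1 | i < d.+1] u.
Proof.
move=> m0; rewrite -Theta_gen -Theta_C /fscale /= mulr1; congr (Theta (_, _) u).
by apply/mnmP => i; rewrite !mnmE prednK // lt0n.
Qed.

(** The support condition in [lower_span] keeps every generator free of a pole along z_i. *)
Lemma Theta_lower_holomorphic m i F u : m i = 0%N -> lower_span m F -> Theta F u = 0.
Proof.
move=> mi; elim=> [f f' ff' _ <-||f f' _ Hf _ Hf'|s c c0 mc].
- by symmetry; exact: Theta_feq.
- exact: Theta_zero.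
- by rewrite Theta_fadd Hf Hf' addr0.
- by apply: (@Theta_holomorphic _ _ i); rewrite mnmDE mi mc.
Qed.

(** By [dpartial1] a nonzero value at 1 needs all exponents equal to 1, but adding [c] to positive
    exponents makes some exponent at least 2. *)
Lemma Theta_lower_pole m F : (forall i, m i != 0%N) -> lower_span m F -> Theta F 1 = 0.
Proof.
move=> m0; elim=> [f f' ff' _ <-||f f' _ Hf _ Hf'|s c c0 mc].
- by symmetry; exact: Theta_feq.
- exact: Theta_zero.
- by rewrite Theta_fadd Hf Hf' addr0.
rewrite Theta_pole => [|i]; last by rewrite mnmDE addn_eq0 negb_and m0.
rewrite dpartial1; have [i ci] := mnm_neq0P c0.
case: eqP => [/mnmP /(_ i)|_]; last exact: mulr0.
by rewrite mnmE mnmDE mnm0E; case: (m i) (m0 i) (c i) ci => // k _ [] //= l; rewrite addnS.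
Qed.

(** * Induction step on the order of the operator *)

Section Linearity.
Variables (n : nat) (D : S -> S).
Hypothesis nD : diffop n.+1 D.
Hypothesis IHn : forall D', diffop n D' ->
  forall f u, Theta (ext (tens D') f) u = D' (Theta f u).

Let lE : locOp (tens D : P -> P) := locOp_tens nD.
Let aD : {morph D : u v / u + v} := Alinear_add nD.1.

(** The identity is kept at a single argument [u], since multiplying the fraction by a y-monomial
    changes the argument. *)
Definition commutes f u := Theta (ext (tens D) f) u = D (Theta f u).

Lemma commutes_feq f f' u : feq f f' -> commutes f u -> commutes f' u.
Proof.
by move=> ff'; rewrite /commutes (Theta_feq _ (ext_feq lE ff')) (Theta_feq _ ff').
Qed.

Lemma commutes_add r r' m u :
  commutes (r, m) u -> commutes (r', m) u -> commutes (r + r', m) u.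
Proof.
move=> H H'; rewrite /commutes (Theta_feq _ (ext_add r r' m lE)) Theta_fadd H H'.
by rewrite Theta_add aD.
Qed.

(** The correction [D, s] has smaller order, so [IHn] evaluates it, and adding it to s D gives D
    s. *)
Lemma commutes_C (s : S) f u : commutes f u -> commutes (fscale s%:MP f) u.
Proof.
move=> H; rewrite /commutes (Theta_feq _ (ext_fscale s%:MP f lE)) Theta_fadd.
rewrite !Theta_C H ad_tensC ?(morph_add0 aD) // IHn; last exact: diffop_comm.
by rewrite /ad addrC subrK.
Qed.

Lemma commutes_X b f u : commutes (fscale 'X_[b] f) u <-> commutes f ('X_[b] * u).
Proof.
rewrite /commutes (Theta_feq _ (ext_fscale 'X_[b] f lE)) Theta_fadd !Theta_X.
rewrite ad_tensX ?(morph_add0 aD) // (Theta_feq _ (ext_op0 f)) Theta_zero.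
by rewrite addr0.
Qed.

Lemma commutes_num m : (forall u, commutes (1, m) u) -> forall r u, commutes (r, m) u.
Proof.
move=> H r u; elim/mpolyind: r => [|s b r _ _ Hr].
  have := commutes_C 0 (H u); apply: commutes_feq.
  by apply: feq_eq; rewrite /= mpolyC0 !mul0r.
apply: commutes_add Hr; rewrite -mul_mpolyC.
have := commutes_C s ((commutes_X b (1, m) u).2 (H _)).
by rewrite /fscale /= mulr1.
Qed.

(** Neither 1 / z^m nor its image has a pole along z_i, so both sides vanish. *)
Lemma commutes_holomorphic m i u : m i = 0%N -> commutes (1, m) u.
Proof.
move=> mi; have [F HF EF] := ext_tens_lead m nD.
rewrite /commutes (Theta_feq _ EF) Theta_fadd.
rewrite (Theta_lower_holomorphic _ mi HF) !(@Theta_holomorphic _ _ i) // addr0.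
by rewrite (morph_add0 aD).
Qed.

(** Only the leading term counts: both sides are [D 1] if all exponents are 1, and 0 otherwise. *)
Lemma commutes_at1 m : (forall i, m i != 0%N) -> commutes (1, m) 1.
Proof.
move=> m0; have [F HF EF] := ext_tens_lead m nD.
rewrite /commutes (Theta_feq _ EF) Theta_fadd (Theta_lower_pole m0 HF) addr0.
rewrite -mpolyC1 !Theta_pole // mpolyC1 dpartial1 mul1r.
by case: eqP; rewrite ?mulr1 // mulr0 (morph_add0 aD).
Qed.

Lemma Theta_Alinear f : Alinear (Theta f).
Proof. by case: (Theta_diff f) => -[|k] []. Qed.

Lemma commutes_linear m :
  (forall b, commutes (1, m) 'X_[b]) -> forall u, commutes (1, m) u.
Proof.
move=> H u; elim/mpolyind: u => [|a b u _ _ Hu].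
  by rewrite /commutes !(morph_add0 (Alinear_add (@Theta_Alinear _))) (morph_add0 aD).
by rewrite /commutes !Theta_Alinear nD.1 H Hu.
Qed.

Lemma commutes_unit m u : commutes (1, m) u.
Proof.
move: {2}(mdeg m) (erefl (mdeg m)) u => k.
elim: k m => [|k IHk] m.
  move/eqP; rewrite mdeg_eq0 => /eqP -> u.
  by apply: (@commutes_holomorphic _ ord0); rewrite mnm0E.
move=> mk; have [/forallP m0|] := boolP [forall i, m i != 0%N]; last first.
  rewrite negb_forall => /existsP [i /negbNE /eqP mi] u; exact: commutes_holomorphic mi.
(* Inner induction on the monomial argument x^b; the outer one is on the degree of [m]. *)
apply: commutes_linear; elim/mnm_ind => [|i b Hb].
  by rewrite mpolyX0; exact: commutes_at1.
rewrite mpolyXD; apply/commutes_X.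
(* y_i = x_i + (y_i - x_i): the first summand is S-linear, the second lowers m. *)
have -> : fscale 'X_i (1, m) = (('X_i : S)%:MP + gP i, m).
  by congr (_, _); rewrite mulr1 addrC subrK.
apply: commutes_add.
  by have := commutes_C ('X_i) Hb; rewrite /fscale /= mulr1.
have mE := mnm_U_decomp (m0 i).
have Hk : mdeg (m - U_(i))%MM = k by move: mk; rewrite mE mdegD mdeg1 => -[] <-; rewrite -mE.
(* Here z_i / z^m = 1 / z^(m - e_i), whose exponent has degree [k]. *)
apply: commutes_feq (IHk _ Hk 'X_[b]).
by apply: feq_eq; rewrite /= mE gpowD gpowU -mE mul1r.
Qed.

Lemma Theta_ext_step f u : Theta (ext (tens D) f) u = D (Theta f u).
Proof. by case: f => r m; apply: commutes_num => v; exact: commutes_unit. Qed.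

End Linearity.

Lemma Theta_ext n D : diffop n D ->
  forall f u, Theta (ext (tens D) f) u = D (Theta f u).
Proof.
elim: n D => [|n IHn] D nD f u; last exact: Theta_ext_step nD IHn f u.
by case: nD => _ /= ->; rewrite tens_op0 (Theta_feq _ (ext_op0 f)) Theta_zero.
Qed.

End Residue.
End Extension.
End Theory.

Theorem theorem3p8 (A : comNzRingType) (d : nat)
    (ext : (Pring A d -> Pring A d) -> lfrac A d -> lfrac A d)
    (Theta : lfrac A d -> Sring A d -> Sring A d) :
  isLocExt ext ->
  (* Theta is a well-defined map H^{d+1}_Delta(P) -> D_{S|A} *)
  (forall f f', sameH f f' -> forall u, Theta f u = Theta f' u) ->
  (forall f, isDiffOp (Theta f)) ->
  (* P-linearity *)
  (forall r r' m u, Theta (r + r', m) u = Theta (r, m) u + Theta (r', m) u) ->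
  (forall (p : Pring A d) f u, Theta (fscale p f) u = Pact p (Theta f) u) ->
  (* values on the generators [1 / prod_i (y_i - x_i)^(a_i + 1)] *)
  (forall (a : 'X_{1..d.+1}) u,
      Theta (1, [multinom (a i).+1 | i < d.+1]) u = dpartial a u) ->
  (* conclusion: Theta is D_{S|A}-linear (D acting on itself by left mult.) *)
  forall delta : Sring A d -> Sring A d, isDiffOp delta ->
  forall f u, Theta (ext (tens1 delta) f) u = delta (Theta f u).
Proof.
move=> ext_loc Theta_sameH Theta_diff Theta_add Theta_scale Theta_gen delta.
move=> /isDiffOp_diffop [n nD] f u.
exact: (Theta_ext ext_loc Theta_sameH Theta_diff Theta_add Theta_scale Theta_gen nD).
Qed.
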